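(* Let $S$ and $T$ be semirings, $P$ an $(S,T)$-bisemimodule (left $S$, right $T$), and $M$ a left $S$-semimodule. (1) If $P_T$ is mono-flat and $M$ is an injective left $S$-semimodule, then $\mathrm{Hom}_S({}_SP,{}_SM)$ is an injective left $T$-semimodule. (2) If the functor $P\otimes_T-:{}_T\mathcal{M}\to{}_S\mathcal{M}$ preserves short exact sequences and $M$ is an e-injective left $S$-semimodule, then $\mathrm{Hom}_S({}_SP,{}_SM)$ is an e-injective left $T$-semimodule.
   Context: A semiring is $(S,+,\cdot,0,1)$ with $(S,+,0)$ a commutative monoid, $(S,\cdot,1)$ a monoid, multiplication distributing over addition on both sides, and $0s=0=s0$ for all $s$. A left $S$-semimodule is a commutative monoid $(M,+,0)$ with a scalar multiplication $S\times M\to M$ satisfying $(ss')m=s(s'm)$, $s(m+m')=sm+sm'$, $(s+s')m=sm+s'm$, $1m=m$, $s0=0=0m$; right semimodules are defined symmetrically, and a bisemimodule has commuting left and right actions. Homomorphisms preserve $+$, $0$ and scalar multiplication; ${}_S\mathcal{M}$ is the category of left $S$-semimodules and $\mathcal{M}$ the category of commutative monoids. The tensor product $P\otimes_TA$ of a right $T$-semimodule $P$ and a left $T$-semimodule $A$ is the commutative monoid universal for maps $P\times A\to C$ into commutative monoids $C$ that are additive and zero-preserving in each variable and $T$-balanced (it is not required to be cancellative); if $P$ is an $(S,T)$-bisemimodule, it is a left $S$-semimodule via $s(p\otimes a)=sp\otimes a$. $P_T$ is mono-flat if $P\otimes_T-$ sends injective homomorphisms of left $T$-semimodules to injective maps.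 $\mathrm{Hom}_S({}_SP,{}_SM)$ is a left $T$-semimodule under $(tf)(p)=f(pt)$. $M\in{}_S\mathcal{M}$ is injective if for every injective homomorphism $\mu:A\to B$ in ${}_S\mathcal{M}$ and every homomorphism $f:A\to M$ there is a homomorphism $\tilde f:B\to M$ with $\tilde f\mu=f$. A sequence $0\to A\xrightarrow{f}B\xrightarrow{g}C\to 0$ in ${}_S\mathcal{M}$ (or in $\mathcal{M}$) is short exact if $f$ is a categorical kernel of $g$ and $g$ is a categorical cokernel of $f$ (kernels and cokernels in the sense of categories with zero morphisms). $M\in{}_S\mathcal{M}$ is e-injective if the contravariant functor $\mathrm{Hom}_S(-,M):{}_S\mathcal{M}\to\mathcal{M}$ sends every short exact sequence $0\to A\to B\to C\to 0$ to a short exact sequence $0\to\mathrm{Hom}_S(C,M)\to\mathrm{Hom}_S(B,M)\to\mathrm{Hom}_S(A,M)\to 0$ in $\mathcal{M}$. *)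

(* Defs.v *)
From HB Require Import structures.
From mathcomp Require Import all_boot all_order all_algebra.
From mathcomp Require Import boolp.

Set Implicit Arguments.
Unset Strict Implicit.
Unset Printing Implicit Defensive.

Import GRing.Theory.
Local Open Scope ring_scope.
Local Open Scope quotient_scope.

(* Semirings are pzSemiRingType (0 = 1 is allowed), commutative monoids are   *)
(* nmodType, and left S-semimodules are lSemiModType S. The eqType and        *)
(* choiceType structures these carry are no restriction: boolp provides them  *)
(* on every type.                                                             *)

HB.mixin Record Nmodule_isRSemiModule (T : pzSemiRingType) V
    of GRing.Nmodule V := {
  rscale : V -> T -> V;
  rscaleA : forall v a b, rscale (rscale v a) b = rscale v (a * b);
  rscale0r : forall v, rscale v 0 = 0;
  rscale1r : forall v, rscale v 1 = v;
  rscaleDl : forall a, {morph rscale^~ a : u v / u + v};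
  rscaleDr : forall v, {morph rscale v : a b / a + b}
}.

#[short(type="rSemiModType")]
HB.structure Definition RSemiModule (T : pzSemiRingType) :=
  {V of GRing.Nmodule V & Nmodule_isRSemiModule T V}.

HB.mixin Record LRSemiModule_isBiSemiModule (S T : pzSemiRingType) V
    of GRing.LSemiModule S V & RSemiModule T V := {
  scale_rscale : forall (s : S) (v : V) (t : T),
    rscale (s *: v) t = s *: rscale v t
}.

#[short(type="biSemiModType")]
HB.structure Definition BiSemiModule (S T : pzSemiRingType) :=
  {V of GRing.LSemiModule S V & RSemiModule T V
      & LRSemiModule_isBiSemiModule S T V}.

Lemma rscaler0 (T : pzSemiRingType) (P : rSemiModType T) (t : T) :
  rscale (0 : P) t = 0.
Proof. by rewrite -(rscale0r (0 : P)) rscaleA mul0r. Qed.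

Section TensorProduct.
Variables (T : pzSemiRingType) (P : rSemiModType T) (A : lSemiModType T).

(* A list of pairs is a formal sum of pure tensors, so concatenation is       *)
(* addition; commutativity of the sum is imposed by tens_catC.                *)
Inductive tens_rel : seq (P * A) -> seq (P * A) -> Prop :=
| tens_refl s : tens_rel s s
| tens_sym s1 s2 : tens_rel s1 s2 -> tens_rel s2 s1
| tens_trans s1 s2 s3 : tens_rel s1 s2 -> tens_rel s2 s3 -> tens_rel s1 s3
| tens_cat s1 s2 s3 s4 :
    tens_rel s1 s2 -> tens_rel s3 s4 -> tens_rel (s1 ++ s3) (s2 ++ s4)
| tens_catC s1 s2 : tens_rel (s1 ++ s2) (s2 ++ s1)
| tens_Dl p q a : tens_rel [:: (p + q, a)] [:: (p, a); (q, a)]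
| tens_Dr p a b : tens_rel [:: (p, a + b)] [:: (p, a); (p, b)]
| tens_0l a : tens_rel [:: (0, a)] [::]
| tens_0r p : tens_rel [:: (p, 0)] [::]
| tens_bal p t a : tens_rel [:: (rscale p t, a)] [:: (p, t *: a)].

Definition tens_relb : rel (seq (P * A)) := fun s1 s2 => `[< tens_rel s1 s2 >].

Lemma tens_relb_refl : reflexive tens_relb.
Proof. by move=> s; apply/asboolP; exact: tens_refl. Qed.

Lemma tens_relb_sym : symmetric tens_relb.
Proof. by move=> s1 s2; apply/asboolP/asboolP; exact: tens_sym. Qed.

Lemma tens_relb_trans : transitive tens_relb.
Proof.
move=> s2 s1 s3 /asboolP h12 /asboolP h23; apply/asboolP.
exact: tens_trans h12 h23.
Qed.

Canonical tens_equiv :=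
  EquivRel tens_relb tens_relb_refl tens_relb_sym tens_relb_trans.

Definition tens := {eq_quot tens_equiv}.

HB.instance Definition _ := Choice.on tens.

Definition tens_pi (s : seq (P * A)) : tens := \pi_{eq_quot tens_equiv} s.

Definition tens_repr (x : tens) : seq (P * A) :=
  repr (x : {eq_quot tens_equiv}).

Definition tens_pure (p : P) (a : A) : tens := tens_pi [:: (p, a)].

Lemma tens_piP s1 s2 : tens_pi s1 = tens_pi s2 <-> tens_rel s1 s2.
Proof.
split=> [/eqmodP /asboolP //|h].
by apply/eqmodP; apply/asboolP.
Qed.

Lemma tens_reprK x : tens_pi (tens_repr x) = x.
Proof. exact: reprK. Qed.

Definition tens_add (x y : tens) : tens :=
  tens_pi (tens_repr x ++ tens_repr y).

Lemma tens_add_pi s1 s2 :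
  tens_add (tens_pi s1) (tens_pi s2) = tens_pi (s1 ++ s2).
Proof. by apply/tens_piP; apply: tens_cat; apply/tens_piP/tens_reprK. Qed.

Lemma tens_addA : associative tens_add.
Proof.
move=> x y z.
by rewrite -(tens_reprK x) -(tens_reprK y) -(tens_reprK z) !tens_add_pi catA.
Qed.

Lemma tens_addC : commutative tens_add.
Proof. by move=> x y; apply/tens_piP; exact: tens_catC. Qed.

Lemma tens_add0 : left_id (tens_pi [::]) tens_add.
Proof. by move=> x; rewrite -(tens_reprK x) tens_add_pi. Qed.

HB.instance Definition _ :=
  GRing.isNmodule.Build tens tens_addA tens_addC tens_add0.

Lemma tens_piD s1 s2 : tens_pi (s1 ++ s2) = tens_pi s1 + tens_pi s2.
Proof. by rewrite -tens_add_pi. Qed.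

Lemma tens_piE s : tens_pi s = \sum_(x <- s) tens_pure x.1 x.2.
Proof.
elim: s => [|[p a] s IHs]; first by rewrite big_nil.
by rewrite big_cons -IHs -cat1s tens_piD.
Qed.

Lemma tens_ind (Q : tens -> Prop) :
  Q 0 -> (forall p a, Q (tens_pure p a)) ->
  (forall x y, Q x -> Q y -> Q (x + y)) -> forall x, Q x.
Proof.
move=> Q0 Qp QD x; rewrite -(tens_reprK x) tens_piE.
by elim/big_ind: _ => // y _; exact: Qp.
Qed.

Definition balanced (C : nmodType) (b : P -> A -> C) : Prop :=
  [/\ forall a, nmod_morphism (b^~ a),
      forall p, nmod_morphism (b p)
    & forall p t a, b (rscale p t) a = b p (t *: a)].

Lemma tens_pure_balanced : balanced tens_pure.
Proof.
split=> [a|p|p t a]; last by apply/tens_piP; exact: tens_bal.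
- split=> [|p q]; first by apply/tens_piP; exact: tens_0l.
  by rewrite -[RHS]tens_piD; apply/tens_piP; exact: tens_Dl.
- split=> [|a b]; first by apply/tens_piP; exact: tens_0r.
  by rewrite -[RHS]tens_piD; apply/tens_piP; exact: tens_Dr.
Qed.

Definition tens_lift (C : nmodType) (b : P -> A -> C) (x : tens) : C :=
  \sum_(y <- tens_repr x) b y.1 y.2.

Section Lift.
Variables (C : nmodType) (b : P -> A -> C).
Hypothesis bb : balanced b.

Lemma tens_rel_lift s1 s2 : tens_rel s1 s2 ->
  \sum_(y <- s1) b y.1 y.2 = \sum_(y <- s2) b y.1 y.2.
Proof.
case: bb => bl br bt; elim=> //.
- by move=> u1 u2 u3 _ -> _ ->.
- by move=> u1 u2 u3 u4 _ h1 _ h2; rewrite !big_cat /= h1 h2.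
- by move=> u1 u2; rewrite !big_cat /= addrC.
- by move=> p q a; rewrite !(big_cons, big_nil) /= !addr0 (bl a).2.
- by move=> p a c; rewrite !(big_cons, big_nil) /= !addr0 (br p).2.
- by move=> a; rewrite !(big_cons, big_nil) /= addr0 (bl a).1.
- by move=> p; rewrite !(big_cons, big_nil) /= addr0 (br p).1.
- by move=> p t a; rewrite !(big_cons, big_nil) /= !addr0 bt.
Qed.

Lemma tens_lift_pi s : tens_lift b (tens_pi s) = \sum_(y <- s) b y.1 y.2.
Proof. by apply: tens_rel_lift; apply/tens_piP; exact: tens_reprK. Qed.

Lemma tens_lift_pure p a : tens_lift b (tens_pure p a) = b p a.
Proof. by rewrite tens_lift_pi big_seq1. Qed.

Lemma tens_lift_nmod : nmod_morphism (tens_lift b).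
Proof.
split; first by rewrite (tens_lift_pi [::]) big_nil.
move=> x y; rewrite -(tens_reprK x) -(tens_reprK y) -tens_piD !tens_lift_pi.
by rewrite big_cat.
Qed.

Lemma tens_universal :
  exists! g : tens -> C,
    nmod_morphism g /\ forall p a, g (tens_pure p a) = b p a.
Proof.
exists (tens_lift b); split; first by split; [exact: tens_lift_nmod|
  exact: tens_lift_pure].
move=> g [[g0 gD] gb]; apply/funext; apply: tens_ind => [|p a|x y hx hy].
- by rewrite g0 tens_lift_nmod.1.
- by rewrite gb tens_lift_pure.
- by rewrite gD tens_lift_nmod.2 hx hy.
Qed.

End Lift.
End TensorProduct.

Section TensorSemiModule.
Variables (S T : pzSemiRingType) (P : biSemiModType S T) (A : lSemiModType T).

Definition tens_scale (s : S) : tens P A -> tens P A :=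
  tens_lift (fun (p : P) (a : A) => tens_pure (s *: p) a).

Lemma tens_scale_balanced s :
  balanced (fun (p : P) (a : A) => tens_pure (s *: p) a).
Proof.
have [hl hr hb] := tens_pure_balanced P A.
split=> [a|p|p t a]; last by rewrite -scale_rscale hb.
- by split=> [|p q]; rewrite ?scaler0 ?scalerDr; [exact: (hl a).1|
    exact: (hl a).2].
- exact: hr.
Qed.

Lemma tens_scale_pure s p a :
  tens_scale s (tens_pure p a) = tens_pure (s *: p) a.
Proof. exact: tens_lift_pure (tens_scale_balanced s) p a. Qed.

Lemma tens_scale_nmod s : nmod_morphism (tens_scale s).
Proof. exact: tens_lift_nmod (tens_scale_balanced s). Qed.

Lemma tens_scaleA s s' x :
  tens_scale s (tens_scale s' x) = tens_scale (s * s') x.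
Proof.
elim/tens_ind: x => [|p a|x y hx hy].
- by rewrite !(tens_scale_nmod _).1.
- by rewrite !tens_scale_pure scalerA.
- by rewrite !(tens_scale_nmod _).2 hx hy.
Qed.

Lemma tens_scale0 x : tens_scale 0 x = 0.
Proof.
elim/tens_ind: x => [|p a|x y hx hy]; first exact: (tens_scale_nmod 0).1.
- have [hl _ _] := tens_pure_balanced P A.
  by rewrite tens_scale_pure scale0r; exact: (hl a).1.
- by rewrite (tens_scale_nmod _).2 hx hy addr0.
Qed.

Lemma tens_scale1 : left_id 1 tens_scale.
Proof.
elim/tens_ind=> [|p a|x y hx hy]; first exact: (tens_scale_nmod 1).1.
- by rewrite tens_scale_pure scale1r.
- by rewrite (tens_scale_nmod _).2 hx hy.
Qed.

Lemma tens_scaleDr : right_distributive tens_scale +%R.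
Proof. by move=> s; exact: (tens_scale_nmod s).2. Qed.

Lemma tens_scaleDl x : {morph tens_scale^~ x : s s' / s + s'}.
Proof.
move=> s s' /=; elim/tens_ind: x => [|p a|x y hx hy].
- by rewrite !(tens_scale_nmod _).1 addr0.
- have [hl _ _] := tens_pure_balanced P A.
  by rewrite !tens_scale_pure scalerDl; exact: (hl a).2.
- by rewrite !(tens_scale_nmod _).2 hx hy addrACA.
Qed.

HB.instance Definition _ := GRing.Nmodule_isLSemiModule.Build S (tens P A)
  tens_scaleA tens_scale0 tens_scale1 tens_scaleDr tens_scaleDl.

End TensorSemiModule.

Section TensorMap.
Variables (T : pzSemiRingType) (P : rSemiModType T) (A B : lSemiModType T).
Variable f : {linear A -> B}.

Definition tens_map : tens P A -> tens P B :=
  tens_lift (fun (p : P) (a : A) => tens_pure p (f a)).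

Lemma tens_map_balanced : balanced (fun (p : P) (a : A) => tens_pure p (f a)).
Proof.
have [hl hr hb] := tens_pure_balanced P B.
split=> [a|p|p t a]; last by rewrite hb linearZ.
- exact: hl.
- by split=> [|a b]; rewrite ?raddf0 ?raddfD; [exact: (hr p).1|
    exact: (hr p).2].
Qed.

Lemma tens_map_pure p a : tens_map (tens_pure p a) = tens_pure p (f a).
Proof. exact: tens_lift_pure tens_map_balanced p a. Qed.

Lemma tens_map_nmod : nmod_morphism tens_map.
Proof. exact: tens_lift_nmod tens_map_balanced. Qed.

HB.instance Definition _ :=
  GRing.isNmodMorphism.Build (tens P A) (tens P B) tens_map tens_map_nmod.

End TensorMap.

Arguments tens_map {T} P {A B} f.

Section TensorMapLinear.
Variables (S T : pzSemiRingType) (P : biSemiModType S T).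
Variables (A B : lSemiModType T) (f : {linear A -> B}).

Lemma tens_map_scalable : scalable (tens_map P f).
Proof.
move=> s x; rewrite -[s *: x]/(tens_scale s x).
rewrite -[RHS]/(tens_scale s (tens_map P f x)).
have [f0 fD] := tens_map_nmod P f.
have [sA0 sAD] := tens_scale_nmod P A s.
have [sB0 sBD] := tens_scale_nmod P B s.
elim/tens_ind: x => [|p a|x y hx hy].
- by rewrite sA0 f0 sB0.
- by rewrite tens_scale_pure !tens_map_pure tens_scale_pure.
- by rewrite sAD !fD sBD hx hy.
Qed.

HB.instance Definition _ := GRing.isScalable.Build S (tens P A) (tens P B) _
  (tens_map P f) tens_map_scalable.

End TensorMapLinear.

Section HomMonoid.
Variables (S : pzSemiRingType) (A M : lSemiModType S).

Definition LinHom := {linear A -> M}.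

HB.instance Definition _ := gen_eqMixin LinHom.
HB.instance Definition _ := gen_choiceMixin LinHom.

Lemma LinHom_ext (f g : LinHom) : f =1 g -> f = g.
Proof.
case: f g => [f [[fD] [fZ]]] [g [[gD] [gZ]]] /= /funext fg.
subst g; congr (GRing.Linear.Pack (GRing.Linear.Class _ _)).
  by congr Algebra.isNmodMorphism.Axioms_; exact: Prop_irrelevance.
by congr GRing.isScalable.Axioms_; exact: Prop_irrelevance.
Qed.

Definition LinHom_zero : LinHom := \0 : {linear A -> M}.
Definition LinHom_add (f g : LinHom) : LinHom := f \+ g : {linear A -> M}.

Lemma LinHom_addA : associative LinHom_add.
Proof. by move=> f g h; apply: LinHom_ext => x; exact: addrA. Qed.

Lemma LinHom_addC : commutative LinHom_add.
Proof. by move=> f g; apply: LinHom_ext => x; exact: addrC. Qed.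

Lemma LinHom_add0 : left_id LinHom_zero LinHom_add.
Proof. by move=> f; apply: LinHom_ext => x; exact: add0r. Qed.

HB.instance Definition _ :=
  GRing.isNmodule.Build LinHom LinHom_addA LinHom_addC LinHom_add0.

End HomMonoid.

Section HomSemiModule.
Variables (S T : pzSemiRingType) (P : biSemiModType S T) (M : lSemiModType S).

Section Scale.
Variables (t : T) (f : LinHom P M).

Definition LinHom_scale_fun (p : P) : M := f (rscale p t).

Lemma LinHom_scale_nmod : nmod_morphism LinHom_scale_fun.
Proof.
by split=> [|p q]; rewrite /LinHom_scale_fun ?rscaler0 ?raddf0 ?rscaleDl ?raddfD.
Qed.

Lemma LinHom_scale_scalable : scalable LinHom_scale_fun.
Proof. by move=> s p; rewrite /LinHom_scale_fun scale_rscale linearZ. Qed.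

HB.instance Definition _ :=
  GRing.isNmodMorphism.Build P M LinHom_scale_fun LinHom_scale_nmod.
HB.instance Definition _ :=
  GRing.isScalable.Build S P M _ LinHom_scale_fun LinHom_scale_scalable.

Definition LinHom_scale : LinHom P M := LinHom_scale_fun : {linear P -> M}.

End Scale.

Lemma LinHom_scaleA t t' f :
  LinHom_scale t (LinHom_scale t' f) = LinHom_scale (t * t') f.
Proof.
by apply: LinHom_ext => p; rewrite /= /LinHom_scale_fun /= /LinHom_scale_fun rscaleA.
Qed.

Lemma LinHom_scale0 f : LinHom_scale 0 f = 0.
Proof.
by apply: LinHom_ext => p; rewrite /= /LinHom_scale_fun rscale0r raddf0.
Qed.

Lemma LinHom_scale1 : left_id 1 LinHom_scale.
Proof. by move=> f; apply: LinHom_ext => p; rewrite /= /LinHom_scale_fun rscale1r. Qed.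

Lemma LinHom_scaleDr : right_distributive LinHom_scale +%R.
Proof. by move=> t f g; exact: LinHom_ext. Qed.

Lemma LinHom_scaleDl f : {morph LinHom_scale^~ f : t t' / t + t'}.
Proof.
move=> t t'; apply: LinHom_ext => p.
by rewrite /= /LinHom_scale_fun rscaleDr raddfD.
Qed.

HB.instance Definition _ := GRing.Nmodule_isLSemiModule.Build T (LinHom P M)
  LinHom_scaleA LinHom_scale0 LinHom_scale1 LinHom_scaleDr LinHom_scaleDl.

End HomSemiModule.

Section HomPrecomp.
Variables (S : pzSemiRingType) (M A B : lSemiModType S) (f : {linear A -> B}).

Definition LinHom_precomp (h : LinHom B M) : LinHom A M := h \o f : {linear A -> M}.

Lemma LinHom_precomp_nmod : nmod_morphism LinHom_precomp.
Proof. by split=> [|g h]; apply: LinHom_ext. Qed.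

HB.instance Definition _ :=
  GRing.isNmodMorphism.Build (LinHom B M) (LinHom A M) LinHom_precomp LinHom_precomp_nmod.

End HomPrecomp.

Arguments LinHom_precomp {S} M {A B} f h.

Section SemiModuleExactness.
Variables (S : pzSemiRingType) (A B C : lSemiModType S).
Variables (f : {linear A -> B}) (g : {linear B -> C}).

Definition is_kernel : Prop :=
  g \o f =1 \0 /\
  forall (X : lSemiModType S) (h : {linear X -> B}), g \o h =1 \0 ->
    exists! h' : {linear X -> A}, f \o h' =1 h.

Definition is_cokernel : Prop :=
  g \o f =1 \0 /\
  forall (X : lSemiModType S) (h : {linear B -> X}), h \o f =1 \0 ->
    exists! h' : {linear C -> X}, h' \o g =1 h.

Definition short_exact : Prop := is_kernel /\ is_cokernel.

End SemiModuleExactness.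

Section MonoidExactness.
Variables (A B C : nmodType) (f : {additive A -> B}) (g : {additive B -> C}).

Definition is_monoid_kernel : Prop :=
  g \o f =1 \0 /\
  forall (X : nmodType) (h : {additive X -> B}), g \o h =1 \0 ->
    exists! h' : {additive X -> A}, f \o h' =1 h.

Definition is_monoid_cokernel : Prop :=
  g \o f =1 \0 /\
  forall (X : nmodType) (h : {additive B -> X}), h \o f =1 \0 ->
    exists! h' : {additive C -> X}, h' \o g =1 h.

Definition monoid_short_exact : Prop := is_monoid_kernel /\ is_monoid_cokernel.

End MonoidExactness.

Definition mono_flat (T : pzSemiRingType) (P : rSemiModType T) : Prop :=
  forall (A B : lSemiModType T) (f : {linear A -> B}),
    injective f -> injective (tens_map P f).

Definition tens_preserves_short_exact (S T : pzSemiRingType)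
    (P : biSemiModType S T) : Prop :=
  forall (A B C : lSemiModType T) (f : {linear A -> B}) (g : {linear B -> C}),
    short_exact f g ->
    short_exact (tens_map P f : {linear tens P A -> tens P B})
                (tens_map P g : {linear tens P B -> tens P C}).

Definition injective_semimodule (S : pzSemiRingType) (M : lSemiModType S) :
    Prop :=
  forall (A B : lSemiModType S) (mu : {linear A -> B}), injective mu ->
    forall f : {linear A -> M}, exists f' : {linear B -> M}, f' \o mu =1 f.

Definition e_injective_semimodule (S : pzSemiRingType) (M : lSemiModType S) :
    Prop :=
  forall (A B C : lSemiModType S) (f : {linear A -> B}) (g : {linear B -> C}),
    short_exact f g -> monoid_short_exact (LinHom_precomp M g) (LinHom_precomp M f).

(* Main.v *)
(* Hom_T(A, Hom_S(P, M)) is naturally isomorphic to Hom_S(P (x)_T A, M), so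
   lifting and exactness for Hom_S(P, M) over T reduce to lifting and exactness
   for M over S after applying the functor P (x)_T -, which preserves
   monomorphisms in (1) and short exact sequences in (2). *)

Require Import Defs.
From mathcomp Require Import all_boot all_order all_algebra.
From HB Require Import structures.
From mathcomp Require Import boolp.

Set Implicit Arguments.
Unset Strict Implicit.
Unset Printing Implicit Defensive.

Import GRing.Theory.
Local Open Scope ring_scope.

(** Uniqueness in [is_monoid_kernel] and [is_monoid_cokernel] is equality of bundled morphisms, so
    pointwise equality has to be upgraded by proof irrelevance. *)
Lemma additive_ext (A B : nmodType) (f g : {additive A -> B}) :
  f =1 g -> f = g.
Proof.
case: f g => [f [[fD]]] [g [[gD]]] /= /funext fg; subst g.
by rewrite (Prop_irrelevance fD gD).
Qed.

(** * Transport of short exactness along isomorphisms of commutative monoids *)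

Section MonoidExactTransport.
Variables (A B C A' B' C' : nmodType).
Variables (f : {additive A -> B}) (g : {additive B -> C}).
Variables (f' : {additive A' -> B'}) (g' : {additive B' -> C'}).
Variables (a : {additive A -> A'}) (a1 : {additive A' -> A}).
Variables (b : {additive B -> B'}) (b1 : {additive B' -> B}).
Variables (c : {additive C -> C'}) (c1 : {additive C' -> C}).
Hypotheses (aK : cancel a a1) (a1K : cancel a1 a).
Hypotheses (bK : cancel b b1) (b1K : cancel b1 b).
Hypothesis cK : cancel c c1.
Hypotheses (fE : b \o f =1 f' \o a) (gE : c \o g =1 g' \o b).

Lemma iso_comp0 : g' \o f' =1 \0 -> g \o f =1 \0.
Proof.
move=> gf0 x; apply: (can_inj cK); rewrite [LHS]gE /=.
by rewrite [b _]fE [LHS]gf0 raddf0.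
Qed.

(** A test map [h] into [B] is moved to [b \o h], factored through [f'], and the factor is brought
    back by [a1]. *)
Lemma iso_monoid_kernel : is_monoid_kernel f' g' -> is_monoid_kernel f g.
Proof.
move=> [gf0 kerf]; split=> [|X h gh0]; first exact: iso_comp0.
have [|k [kE k_uniq]] := kerf X (b \o h : {additive X -> B'}).
  by move=> x /=; rewrite -[LHS]gE /= [g _]gh0 raddf0.
exists (a1 \o k : {additive X -> A}); split=> [x|l lE].
  by apply: (can_inj bK); rewrite [LHS]fE /= a1K [LHS]kE.
apply: additive_ext => x; apply: (can_inj aK); rewrite /= a1K.
(* Any factor [l] of [h] gives the factor [a \o l] of [b \o h], which must be [k]. *)
rewrite (k_uniq (a \o l : {additive X -> A'})) // => y /=.
by rewrite -[LHS]fE /= [f _]lE.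
Qed.

Lemma iso_monoid_cokernel : is_monoid_cokernel f' g' -> is_monoid_cokernel f g.
Proof.
move=> [gf0 cokg]; split=> [|X h hf0]; first exact: iso_comp0.
(* The inverses commute with the maps too, so [h \o b1] vanishes on the image of [f']. *)
have b1fE x : b1 (f' x) = f (a1 x).
  by apply: (can_inj bK); rewrite b1K [RHS]fE /= a1K.
have [|k [kE k_uniq]] := cokg X (h \o b1 : {additive B' -> X}).
  by move=> x /=; rewrite b1fE [LHS]hf0.
exists (k \o c : {additive C -> X}); split=> [x|l lE].
  by rewrite /= [c _]gE [LHS]kE /= bK.
apply: additive_ext => x.
(* The map [l \o c1] factors [h \o b1] through [g'], hence equals [k]. *)
rewrite (k_uniq (l \o c1 : {additive C' -> X})) /= ?cK // => y /=.
by rewrite -[in LHS](b1K y) -[g' _]gE /= cK [LHS]lE.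
Qed.

Lemma iso_monoid_short_exact :
  monoid_short_exact f' g' -> monoid_short_exact f g.
Proof.
by move=> [kerf cokg]; split; [exact: iso_monoid_kernel|
  exact: iso_monoid_cokernel].
Qed.

End MonoidExactTransport.

(** * The adjunction between tensor product and Hom *)

Section TensorHom.
Variables (S T : pzSemiRingType) (P : biSemiModType S T) (M : lSemiModType S).
Variable A : lSemiModType T.

Section Curry.
Variable phi : {linear tens P A -> M}.

(** Currying is done in two layers: [curry_at a] must be [S]-linear before it can be a value in
    [LinHom P M]. *)
Definition curry_at (a : A) (p : P) : M := phi (tens_pure p a).

Lemma curry_at_nmod a : nmod_morphism (curry_at a).
Proof.
have [hl _ _] := tens_pure_balanced P A.
by split=> [|p q]; rewrite /curry_at ((hl a).1, (hl a).2) (raddf0, raddfD).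
Qed.

Lemma curry_at_scalable a : scalable (curry_at a).
Proof. by move=> s p; rewrite /curry_at -tens_scale_pure -linearZ. Qed.

HB.instance Definition _ a :=
  GRing.isNmodMorphism.Build P M (curry_at a) (curry_at_nmod a).
HB.instance Definition _ a :=
  GRing.isScalable.Build S P M _ (curry_at a) (curry_at_scalable a).

Definition curry_fun (a : A) : LinHom P M := curry_at a : {linear P -> M}.

Lemma curry_fun_nmod : nmod_morphism curry_fun.
Proof.
have [_ hr _] := tens_pure_balanced P A.
split=> [|a b]; apply: LinHom_ext => p /=; rewrite /curry_at.
  by rewrite (hr p).1 raddf0.
by rewrite (hr p).2 raddfD.
Qed.

(** Scaling a map by [t] acts on its argument [p] from the right, so this is the balance relation of
    the tensor product. *)
Lemma curry_fun_scalable : scalable curry_fun.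
Proof.
have [_ _ hb] := tens_pure_balanced P A.
by move=> t a; apply: LinHom_ext => p; rewrite /= /curry_at -hb.
Qed.

HB.instance Definition _ :=
  GRing.isNmodMorphism.Build A (LinHom P M) curry_fun curry_fun_nmod.
HB.instance Definition _ :=
  GRing.isScalable.Build T A (LinHom P M) _ curry_fun curry_fun_scalable.

End Curry.

Definition tens_curry (phi : LinHom (tens P A) M) : LinHom A (LinHom P M) :=
  curry_fun phi : {linear A -> LinHom P M}.

Section Uncurry.
Variable psi : {linear A -> LinHom P M}.

(** Balance is the [T]-linearity of [psi], read through [(tf)(p) = f(pt)]. *)
Lemma uncurry_balanced : balanced (fun (p : P) (a : A) => psi a p).
Proof.
split=> [a|p|p t a]; last by rewrite linearZ.
  by split=> [|p q]; rewrite (raddf0, raddfD).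
by split=> [|a b]; rewrite (raddf0, raddfD).
Qed.

Definition uncurry_fun : tens P A -> M :=
  tens_lift (fun (p : P) (a : A) => psi a p).

Lemma uncurry_fun_nmod : nmod_morphism uncurry_fun.
Proof. exact: tens_lift_nmod uncurry_balanced. Qed.

Lemma uncurry_fun_pure p a : uncurry_fun (tens_pure p a) = psi a p.
Proof. exact: tens_lift_pure uncurry_balanced p a. Qed.

Lemma uncurry_fun_scalable : scalable uncurry_fun.
Proof.
have [u0 uD] := uncurry_fun_nmod.
move=> s; elim/tens_ind=> [|p a|x y hx hy].
- by rewrite scaler0 u0 scaler0.
- by rewrite -[s *: _]/(tens_scale s _) tens_scale_pure !uncurry_fun_pure linearZ.
- by rewrite scalerDr !uD hx hy scalerDr.
Qed.

HB.instance Definition _ :=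
  GRing.isNmodMorphism.Build (tens P A) M uncurry_fun uncurry_fun_nmod.
HB.instance Definition _ :=
  GRing.isScalable.Build S (tens P A) M _ uncurry_fun uncurry_fun_scalable.

End Uncurry.

Definition tens_uncurry (psi : LinHom A (LinHom P M)) : LinHom (tens P A) M :=
  uncurry_fun psi : {linear tens P A -> M}.

Lemma tens_uncurryK : cancel tens_uncurry tens_curry.
Proof.
move=> psi; apply: LinHom_ext => a; apply: LinHom_ext => p.
exact: uncurry_fun_pure.
Qed.

(** Pure tensors generate the tensor product as a commutative monoid. *)
Lemma LinHom_tens_ext (phi phi' : LinHom (tens P A) M) :
  (forall p a, phi (tens_pure p a) = phi' (tens_pure p a)) -> phi = phi'.
Proof.
move=> eq_pure; apply: LinHom_ext; apply: tens_ind => // [|x y hx hy].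
  by rewrite !raddf0.
by rewrite !raddfD /= hx hy.
Qed.

Lemma tens_curryK : cancel tens_curry tens_uncurry.
Proof.
by move=> phi; apply: LinHom_tens_ext => p a; exact: uncurry_fun_pure.
Qed.

Lemma tens_curry_nmod : nmod_morphism tens_curry.
Proof.
by split=> [|phi phi']; apply: LinHom_ext => a; apply: LinHom_ext.
Qed.

(** The inverse of an additive bijection is additive: compare both sides after applying
    [tens_curry]. *)
Lemma tens_uncurry_nmod : nmod_morphism tens_uncurry.
Proof.
split=> [|psi psi']; apply: (can_inj tens_curryK).
  by rewrite tens_uncurryK tens_curry_nmod.1.
by rewrite tens_curry_nmod.2 !tens_uncurryK.
Qed.

HB.instance Definition _ := GRing.isNmodMorphism.Build
  (LinHom (tens P A) M) (LinHom A (LinHom P M)) tens_curry tens_curry_nmod.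
HB.instance Definition _ := GRing.isNmodMorphism.Build
  (LinHom A (LinHom P M)) (LinHom (tens P A) M) tens_uncurry tens_uncurry_nmod.

End TensorHom.

(** These are the commuting squares needed for transport; both sides send the pure tensor of [p] and
    [a] to [psi (f a) p]. *)
Lemma tens_uncurry_natural (S T : pzSemiRingType) (P : biSemiModType S T)
    (M : lSemiModType S) (A B : lSemiModType T) (f : {linear A -> B})
    (psi : LinHom B (LinHom P M)) :
  tens_uncurry (LinHom_precomp (LinHom P M) f psi) =
  LinHom_precomp M (tens_map P f) (tens_uncurry psi).
Proof.
apply: LinHom_tens_ext => p a /=.
by rewrite uncurry_fun_pure tens_map_pure uncurry_fun_pure.
Qed.

Theorem proposition3p4 (S T : pzSemiRingType) (P : biSemiModType S T)
    (M : lSemiModType S) :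
  (mono_flat P -> injective_semimodule M ->
     injective_semimodule (LinHom P M : lSemiModType T)) /\
  (tens_preserves_short_exact P -> e_injective_semimodule M ->
     e_injective_semimodule (LinHom P M : lSemiModType T)).
Proof.
split=> [flatP injM A B mu mu_inj f|exP injM A B C f g fg_exact].
  (* Flatness makes [tens_map P mu] injective, so the transpose of [f] extends along it. *)
  have [h hE] := injM _ _ (tens_map P mu) (flatP _ _ _ mu_inj) (tens_uncurry f).
  exists (tens_curry h) => a; apply: LinHom_ext => p /=.
  rewrite /curry_at -tens_map_pure [LHS]hE; exact: uncurry_fun_pure.
(* Hom is contravariant, so the square of [g] comes first; exactness is transported from the
   sequence of maps into [M] out of the tensored sequence. *)
exact: (iso_monoid_short_exact
  (@tens_uncurryK _ _ _ _ _) (@tens_curryK _ _ _ _ _)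
  (@tens_uncurryK _ _ _ _ _) (@tens_curryK _ _ _ _ _)
  (@tens_uncurryK _ _ _ _ _)
  (tens_uncurry_natural g) (tens_uncurry_natural f)
  (injM _ _ _ _ _ (exP _ _ _ _ _ fg_exact))).
Qed.
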